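(* Let $d\ge 1$ and let $x_1,\dots,x_d\in(0,1]$ be any set of distinct points. For a continuous even function $f$ on $[-1,1]$, compute $$q_1=q_1(f)=\frac{\det[\,g,\ P_3(:),\ \dots,\ P_{2d-1}(:)\,]}{\det[\,P_1(:),\ P_3(:),\ \dots,\ P_{2d-1}(:)\,]},$$ where $g=\big((f(x_i)-f(0))/x_i\big)_{i=1}^d$ and $P_{2j-1}(:)=(P_{2j-1}(x_i))_{i=1}^d$, $j=1,\dots,d$, are column vectors. Then the quadrature $$\int_{-1}^1 f(x)\,dx\approx \frac23\, q_1+2f(0)$$ is exact (i.e. holds with equality) for all even polynomial functions $f$ of degree $\le 2d$. Moreover, for any continuous function $f$ on $[-1,1]$ (not necessarily even), let $f=f_e+f_o$ with even part $f_e(x)=(f(x)+f(-x))/2$ and odd part $f_o(x)=(f(x)-f(-x))/2$, and let $q_{1,e}=q_1(f_e)$ be computed by the same formula with $f_e$ in the place of $f$. Then $$\int_{-1}^1 f(x)\,dx\approx \frac23\, q_{1,e}+2f(0).$$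
   Context: For $m\ge 0$, $P_m$ denotes the Legendre orthogonal polynomial of degree $m$ on $[-1,1]$ with leading coefficient $1$. Equivalently, by Cramer's rule, $q_1$ is the first component of the unique solution $(q_1,\dots,q_d)$ of the linear interpolation system $$\sum_{j=1}^d q_jP_{2j-1}(x_i)=\frac{f(x_i)-f(0)}{x_i},\qquad i=1,\dots,d.$$ The symbol $\approx$ denotes a quadrature rule approximating the integral. *)

(* Defs.v *)
From HB Require Import structures.
From mathcomp Require Import all_boot all_order all_algebra.
From mathcomp Require Import all_classical all_reals all_analysis.

Set Implicit Arguments.
Unset Strict Implicit.
Unset Printing Implicit Defensive.

Import Order.TTheory GRing.Theory Num.Theory.
Import numFieldNormedType.Exports.

Local Open Scope classical_set_scope.
Local Open Scope ring_scope.

Section Definitions.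
Variable R : realType.
Implicit Types (f : R -> R) (P : nat -> {poly R}).

Definition integral11 f : R :=
  \int[@lebesgue_measure R]_(z in `[(-1 : R), 1]) f z.

(* Unique by Gram-Schmidt; existence is [legendre_exists] below. *)
Definition legendre P : Prop :=
  [/\ forall m, P m \is monic,
      forall m, size (P m) = m.+1 &
      forall m n, m != n -> integral11 (fun z => (P m).[z] * (P n).[z]) = 0].

Definition continuous11 f : Prop := {within `[(-1 : R), 1], continuous f}.

Definition even11 f : Prop := forall z, z \in `[(-1 : R), 1] -> f (- z) = f z.

Definition even_part f (z : R) : R := (f z + f (- z)) / 2.
Definition odd_part f (z : R) : R := (f z - f (- z)) / 2.

(* Columns are numbered from 0: column [j] carries [P_(2j+1)]. *)
Definition legendre_mx P (d : nat) (x : 'I_d -> R) : 'M[R]_d :=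
  \matrix_(i < d, j < d) (P j.*2.+1).[x i].

Definition cramer_mx P (d : nat) (x : 'I_d -> R) f : 'M[R]_d :=
  \matrix_(i < d, j < d)
    if j == 0%N :> nat then (f (x i) - f 0) / x i else (P j.*2.+1).[x i].

Definition q1 P (d : nat) (x : 'I_d -> R) f : R :=
  \det (cramer_mx P x f) / \det (legendre_mx P x).

Definition even_quad P (d : nat) (x : 'I_d -> R) f : R :=
  2 / 3 * q1 P x f + 2 * f 0.

Definition quad P (d : nat) (x : 'I_d -> R) f : R :=
  2 / 3 * q1 P x (even_part f) + 2 * f 0.

(* [Q] is a quadrature rule on the class [C]: a weighted sum of values at
   fixed nodes of [-1, 1], with weights that do not depend on the function. *)
Definition quadrature_rule (nodes : seq R) (C : (R -> R) -> Prop)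
    (Q : (R -> R) -> R) : Prop :=
  {in nodes, forall t, t \in `[(-1 : R), 1]} /\
  exists w : R -> R, forall f, C f -> Q f = \sum_(t <- nodes) w t * f t.

Definition exact_at (Q : (R -> R) -> R) f : Prop := integral11 f = Q f.

End Definitions.

Section LegendreExists.
Variable R : realType.
Implicit Types (p q : {poly R}).

Let mu := @lebesgue_measure R.
Let I11 : set R := `[(-1 : R), 1].

Let ip p q : R := integral11 (fun z => p.[z] * q.[z]).

Lemma integrable11_poly p : mu.-integrable I11 (EFin \o (fun z => p.[z])).
Proof.
apply: continuous_compact_integrable; first exact: segment_compact.
by apply: continuous_subspaceT; exact: continuous_horner.
Qed.

Let ipE p q : ip p q = integral11 (fun z => (p * q).[z]).
Proof. by congr integral11; apply/funext => z; rewrite hornerM. Qed.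

Let ipC p q : ip p q = ip q p.
Proof. by rewrite !ipE mulrC. Qed.

Let ipDl p1 p2 q : ip (p1 + p2) q = ip p1 q + ip p2 q.
Proof.
rewrite !ipE mulrDl /integral11 -RintegralD//; try exact: integrable11_poly.
by congr Rintegral; apply/funext => z; rewrite hornerD.
Qed.

Let ipZl a p q : ip (a *: p) q = a * ip p q.
Proof.
rewrite !ipE -scalerAl /integral11 -RintegralZl//; last exact: integrable11_poly.
by congr Rintegral; apply/funext => z; rewrite hornerZ.
Qed.

Let ip0l q : ip 0 q = 0.
Proof. by rewrite -(scale0r (0 : {poly R})) ipZl mul0r. Qed.

Let ip_suml (J : Type) (r : seq J) (F : J -> {poly R}) q :
  ip (\sum_(j <- r) F j) q = \sum_(j <- r) ip (F j) q.
Proof.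
elim: r => [|j r IH]; first by rewrite !big_nil ip0l.
by rewrite !big_cons ipDl IH.
Qed.

Let finite_roots p : p != 0 -> finite_set [set z : R | root p z].
Proof.
move=> pn0; apply: contrapT => /(infinite_set_fset (size p))[B sB].
rewrite leqNgt => /negP; apply; apply: max_poly_roots => //.
  by apply/allP => z zB; exact: sB.
exact: finmap.fset_uniq.
Qed.

Let ip_eq0 p : ip p p = 0 -> p = 0.
Proof.
move=> p0; apply/eqP/negPn/negP => pn0.
have q_int := integrable11_poly (p * p).
have mI : measurable (I11 : set (measurableTypeR R)) by exact: measurable_itv.
have : (\int[mu]_(z in I11) `|((p * p).[z])%:E| = 0)%E.
  transitivity (\int[mu]_(z in I11) ((p * p).[z])%:E)%E.
    apply: eq_integral => z _ /=.
    by rewrite ger0_norm// hornerM -expr2 sqr_ge0.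
  have fin := integrable_fin_num mI q_int.
  by rewrite -(fineK fin); congr EFin; move: p0; rewrite ipE.
move/(ae_eq_integral_abs mu mI (measurable_int mu q_int)) => N0.
have Z0 : mu.-negligible [set z : R | root p z].
  have cZ : countable [set z : R | root p z].
    by apply: finite_set_countable; exact: finite_roots.
  exists [set z : R | root p z]; split => //.
    exact: countable_measurable.
  exact: countable_lebesgue_measure0.
have [N [mN muN IN]] : mu.-negligible I11.
  apply: negligibleS (negligibleU N0 Z0) => z Iz /=.
  have [pz|pz] := boolP (root p z); [by right|left => /(_ Iz)[]].
  by move/eqP; rewrite hornerM mulf_eq0 orbb => /eqP/rootP; exact/negP.
have : mu I11 = 0%E by apply: subset_measure0 muN.
rewrite /mu lebesgue_measure_itv/= lte_fin (_ : (-1 < 1 :> R)) ?ltrN10 => [/eqP|]; last first.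
  by rewrite (lt_trans (ltrN10 R)).
by rewrite -EFinD eqe opprK -(natrD _ 1 1) pnatr_eq0.
Qed.

Let lin n (v : 'rV[R]_n) : {poly R} := \sum_(i < n) v 0 i *: 'X^i.

Let linE n (v : 'rV[R]_n) (j : 'I_n) : (lin v)`_j = v 0 j.
Proof.
rewrite /lin coef_sum (bigD1 j)//= coefZ coefXn eqxx mulr1 big1 ?addr0// => i ij.
by rewrite coefZ coefXn eq_sym (negbTE (_ : i != j :> nat)) ?mulr0.
Qed.

Let size_lin n (v : 'rV[R]_n) : (size (lin v) <= n)%N.
Proof.
apply: (leq_trans (size_sum _ _ _)); apply/bigmax_leqP => i _.
by apply: (leq_trans (size_scale_leq _ _)); rewrite size_polyXn.
Qed.

Let gram n : 'M[R]_n := \matrix_(i, j) ip 'X^i 'X^j.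

Let ip_lin n (v : 'rV[R]_n) (j : 'I_n) : ip (lin v) 'X^j = (v *m gram n) 0 j.
Proof.
by rewrite /lin ip_suml mxE; apply: eq_bigr => i _; rewrite ipZl mxE.
Qed.

Let gram_unit n : gram n \in unitmx.
Proof.
rewrite unitmxE unitfE; apply/negP => /det0P[v vn0 vG].
have /ip_eq0 lv0 : ip (lin v) (lin v) = 0.
  rewrite {1}/lin ip_suml big1// => i _.
  by rewrite ipZl ipC ip_lin vG mxE mulr0.
move/eqP: vn0; apply; apply/rowP => j.
by rewrite -linE lv0 coef0 mxE.
Qed.

Let legendre_poly_exists n : exists p : {poly R},
  [/\ p \is monic, size p = n.+1 &
      forall q, (size q <= n)%N -> ip p q = 0].
Proof.
pose c := - (\row_(j < n) ip 'X^n 'X^j) *m invmx (gram n).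
have lt_c : (size (lin c) < size ('X^n : {poly R}))%N.
  by rewrite size_polyXn ltnS; exact: size_lin.
exists ('X^n + lin c); split.
- by rewrite monicE lead_coefDl// lead_coefXn.
- by rewrite size_polyDl// size_polyXn.
move=> q qn; rewrite ipC -(coefK q) poly_def ip_suml big1// => i _.
have ltin : (i < n)%N := leq_trans (ltn_ord i) qn.
rewrite ipZl ipC ipDl (ip_lin c (Ordinal ltin)) mulmxKV ?gram_unit//.
by rewrite !mxE subrr mulr0.
Qed.

Lemma legendre_exists : exists P : nat -> {poly R}, legendre P.
Proof.
have [P HP] := choice legendre_poly_exists.
exists P; split=> [m|m|m n].
- by have [] := HP m.
- by have [] := HP m.
have [_ sm om] := HP m; have [_ sn on] := HP n.
rewrite neq_ltn => /orP[mn|nm]; last by apply: om; rewrite sn.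
by rewrite -[LHS]/(ip (P m) (P n)) ipC; apply: on; rewrite sm.
Qed.

End LegendreExists.

(* Main.v *)
Require Import Defs.
From HB Require Import structures.
From mathcomp Require Import all_boot all_order all_algebra.
From mathcomp Require Import all_classical all_reals all_analysis.
From mathcomp Require Import ring lra.

Set Implicit Arguments.
Unset Strict Implicit.
Unset Printing Implicit Defensive.

Import Order.TTheory GRing.Theory Num.Theory.
Import numFieldNormedType.Exports.

Local Open Scope classical_set_scope.
Local Open Scope ring_scope.

(** Write [integral p] for the integral of a polynomial over [-1, 1]. The form
    [(p, q) |-> integral (p * q)] is definite, so [P_m] is the only monic
    polynomial of degree [m] orthogonal to all lower degrees. Reflecting
    [z |-> - z] preserves the integral, hence preserves that characterization
    up to the sign of the leading coefficient: [P_m] has the parity of [m]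
    ([legendre_parity]), and in particular [P_1 = X].

    A combination [c_0 P_1 + c_1 P_3 + ...] of [d] terms is therefore odd of
    degree at most [2d - 1]. If it vanishes at the [d] points [x_i > 0], it
    vanishes at the [2d] distinct points [x_i] and [- x_i], so it is zero
    ([odd_poly_eq0]). This makes the interpolation matrix invertible
    ([det_legendre_mx_neq0]), and the same count of roots shows that every odd
    polynomial of degree at most [2d - 1] is such a combination
    ([odd_interpolation]).

    An even polynomial [p] of degree at most [2d] is [p(0) + X g] with [g] odd
    of degree at most [2d - 1], so [g = c_0 P_1 + c_1 P_3 + ...]. The values of
    [g] at the nodes are the right-hand side of the interpolation system, hence
    Cramer's rule gives [q_1 = c_0] ([q1_interpolant]). Since [X = P_1],
    orthogonality leaves
    [integral p = 2 p(0) + c_0 integral (X ^ 2) = 2 p(0) + 2/3 c_0],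
    which is exactness ([even_quad_exact]).

    Expanding the numerator of [q_1] along its first column displays the value
    of the quadrature as a fixed combination of [f(0)] and the [f(x_i)]
    ([even_quadE]), so it is a quadrature rule and depends on [f] only through
    those values. For arbitrary continuous [f], reflection invariance gives
    [f] and its even part the same integral, and the rule for [f] is the one
    for its even part. *)

(** * Polynomials, reflection and vanishing *)

Section RealPolynomials.
Variable R : realType.
Implicit Types p : {poly R}.

(** The reciprocals [1 / (k + 1)] already give more roots than the degree. *)
Lemma poly_eq0_itv11 p : {in `[(-1 : R), 1], forall z, p.[z] = 0} -> p = 0.
Proof.
move=> p0; apply/eqP/negPn/negP => pn0.
pose rs : seq R := [seq k.+1%:R^-1 | k <- iota 0 (size p)].
suff: (size rs < size p)%N by rewrite size_map size_iota ltnn.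
apply: max_poly_roots => //.
  apply/allP => _ /mapP[k _ ->]; apply/rootP/p0.
  rewrite in_itv/= invf_le1 ?ler1n ?ltr0n// andbT.
  by rewrite (le_trans (lerN10 R))// invr_ge0 ler0n.
rewrite map_inj_uniq ?iota_uniq// => i j /invr_inj/eqP.
by rewrite eqr_nat eqSS => /eqP.
Qed.

Lemma comp_polyNX p z : (p \Po - 'X).[z] = p.[- z].
Proof. by rewrite horner_comp hornerN hornerX. Qed.

Lemma coef_comp_NX p i : (p \Po - 'X)`_i = (-1) ^+ i * p`_i.
Proof.
rewrite coef_comp_poly.
under eq_bigr => j _ do rewrite exprNn -polyC1 -polyCN -polyC_exp coefCM coefXn.
have [ip|pi] := ltnP i (size p).
  rewrite (bigD1 (Ordinal ip))//= eqxx mulr1 mulrC big1 ?addr0// => j.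
  by rewrite -val_eqE/= eq_sym => /negbTE ->; rewrite !mulr0.
rewrite big1 ?(nth_default _ pi) ?mulr0// => j _.
by rewrite gtn_eqF ?mulr0// (leq_trans (ltn_ord j)).
Qed.

Lemma size_drop_lead m p : (size p <= m.+1)%N -> p`_m = 0 -> (size p <= m)%N.
Proof.
move=> pm p0; apply/leq_sizeP => j; rewrite leq_eqVlt => /orP[/eqP <-//|mj].
by rewrite nth_default// (leq_trans pm).
Qed.

End RealPolynomials.

(** * Integration of polynomials over [-1, 1] *)

Section PolynomialIntegral.
Variable R : realType.
Implicit Types (p q r : {poly R}) (f : R -> R).

Definition ipoly p : R := integral11 (horner p).

Lemma continuous11_horner p : continuous11 (horner p).
Proof. by apply: continuous_subspaceT; exact: continuous_horner. Qed.

Lemma integrable11 f : continuous11 f ->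
  (@lebesgue_measure R).-integrable `[(-1 : R), 1] (EFin \o f).
Proof. by apply: continuous_compact_integrable; exact: segment_compact. Qed.

(** With [deriv_surj], this reduces the linearity and the definiteness of
    [ipoly] to statements about antiderivatives. *)
Lemma ipoly_deriv q : ipoly q^`() = q.[1] - q.[-1].
Proof.
rewrite /ipoly /integral11 /Rintegral (@continuous_FTC2 _ _ (horner q))//.
- exact: continuous11_horner.
- split; first by move=> z _; exact: derivable_horner.
  + by apply: cvg_at_right_filter; exact: continuous_horner.
  + by apply: cvg_at_left_filter; exact: continuous_horner.
- by move=> z _; rewrite derivE.
Qed.

Lemma deriv_surj p : exists q, q^`() = p.
Proof.
exists (\poly_(i < (size p).+1) (p`_i.-1 / i%:R)); apply/polyP => i.
rewrite coef_deriv coef_poly ltnS; case: ltnP => [_|pi].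
  by rewrite -[LHS]mulr_natr divfK ?pnatr_eq0.
by rewrite mul0rn nth_default.
Qed.

Lemma ipolyD p q : ipoly (p + q) = ipoly p + ipoly q.
Proof.
have [[p' <-] [q' <-]] := (deriv_surj p, deriv_surj q).
by rewrite -derivD !ipoly_deriv !hornerD; ring.
Qed.

Lemma ipolyZ a p : ipoly (a *: p) = a * ipoly p.
Proof.
have [p' <-] := deriv_surj p.
by rewrite -derivZ !ipoly_deriv !hornerZ; ring.
Qed.

Lemma ipoly0 : ipoly 0 = 0.
Proof. by rewrite -(scale0r 0) ipolyZ mul0r. Qed.

Lemma ipoly_sum (J : Type) (s : seq J) (Q : pred J) (F : J -> {poly R}) :
  ipoly (\sum_(j <- s | Q j) F j) = \sum_(j <- s | Q j) ipoly (F j).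
Proof. by rewrite (big_morph ipoly ipolyD ipoly0). Qed.

(** An antiderivative of [p ^ 2] is nondecreasing on [-1, 1] and, when the
    integral vanishes, takes the same value at both ends; it is then constant on
    [-1, 1], so it is a constant polynomial and its derivative is zero. *)
Lemma ipoly_sq_eq0 p : ipoly (p * p) = 0 -> p = 0.
Proof.
have [q qE] := deriv_surj (p * p).
rewrite -qE ipoly_deriv => /eqP; rewrite subr_eq0 => /eqP q1E.
have q_ndecr : {in `[(-1 : R), 1] &, {homo horner q : y z / y <= z}}.
  apply: ger0_derive1_le_cc.
  - by move=> z _; exact: derivable_horner.
  - by move=> z _; rewrite -derivE qE hornerM -expr2 sqr_ge0.
  - exact: continuous11_horner.
have b1 : 1 \in `[(-1 : R), 1] by rewrite in_itv/= lexx andbT; lra.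
have bN1 : -1 \in `[(-1 : R), 1] by rewrite in_itv/= lexx; lra.
have qC : q - q.[1]%:P = 0.
  apply: poly_eq0_itv11 => z zI; apply/eqP.
  have := zI; rewrite in_itv/= => /andP[z1 z2].
  rewrite hornerD hornerN hornerC subr_eq0 eq_le q_ndecr//= q1E.
  exact: q_ndecr.
have /eqP : p * p = 0 by rewrite -qE (subr0_eq qC) derivC.
by rewrite mulf_eq0 orbb => /eqP.
Qed.

Lemma integral11_opp f : continuous11 f ->
  integral11 (fun z => f (- z)) = integral11 f.
Proof.
move=> cf; congr fine.
have := @integration_by_substitution_oppr R f (-1) 1.
by rewrite opprK => <-//; lra.
Qed.

Lemma ipoly_opp p : ipoly (p \Po - 'X) = ipoly p.
Proof.
rewrite -[RHS](integral11_opp (@continuous11_horner p)).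
by congr integral11; apply/funext => z; rewrite comp_polyNX.
Qed.

Lemma ipolyX2 : ipoly ('X * 'X) = 2 / 3.
Proof.
suff -> : 'X * 'X = ((1 / 3 : R) *: 'X^3)^`().
  by rewrite ipoly_deriv !hornerZ !hornerXn; field.
rewrite derivZ derivXn -scalerMnr scalerMnl expr2.
by rewrite -[_ *+ 3]mulr_natr divfK ?scale1r// pnatr_eq0.
Qed.

End PolynomialIntegral.

(** * Even parts of continuous functions *)

Section EvenPart.
Variable R : realType.
Implicit Types f : R -> R.

Lemma continuous11_opp f :
  continuous11 f -> continuous11 (fun z => f (- z)).
Proof.
move=> cf; apply: (@within_continuous_compN _ _ _ f); rewrite opprK.
exact: cf.
Qed.

Lemma continuous11_addN f :
  continuous11 f -> continuous11 (fun z => f z + f (- z)).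
Proof.
move=> cf z; have cfN := continuous11_opp cf.
by apply: continuousD; [exact: cf|exact: cfN].
Qed.

Lemma continuous11_even_part f :
  continuous11 f -> continuous11 (even_part f).
Proof.
by move=> /continuous11_addN cS z; exact: cvgMr_tmp (cS z).
Qed.

Lemma integral11_even_part f : continuous11 f ->
  integral11 (even_part f) = integral11 f.
Proof.
move=> cf; have cfN := continuous11_opp cf.
have sumI : integral11 (fun z => f z + f (- z)) = integral11 f + integral11 f.
  rewrite -{2}(integral11_opp cf).
  by apply: RintegralD => //; exact: integrable11.
have cS := continuous11_addN cf.
have -> : integral11 (even_part f) = 2^-1 * integral11 (fun z => f z + f (- z)).
  rewrite /integral11 -RintegralZl//; last exact: integrable11.
  by congr Rintegral; apply/funext => z; rewrite /even_part mulrC.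
by rewrite sumI; field.
Qed.

End EvenPart.

(** * Parity of the Legendre polynomials *)

Section Legendre.
Variables (R : realType) (P : nat -> {poly R}).
Hypothesis HP : legendre P.
Implicit Types (p q r : {poly R}).

Lemma legendre_orth m n : m != n -> ipoly (P m * P n) = 0.
Proof.
have [_ _ orth] := HP; move=> /orth <-.
by congr integral11; apply/funext => z; rewrite hornerM.
Qed.

Lemma legendre_sq_neq0 m : ipoly (P m * P m) != 0.
Proof.
have [mon _ _] := HP.
by apply/eqP => /ipoly_sq_eq0/eqP; rewrite (negbTE (monic_neq0 (mon m))).
Qed.

Lemma coef_legendre_lead m : (P m)`_m = 1.
Proof.
have [mon sz _] := HP.
by have /monicP := mon m; rewrite /lead_coef sz.
Qed.

(** [P_0, ..., P_(m-1)] span the polynomials of degree less than [m]: leading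
    terms are removed one at a time by multiples of the [P_k]. *)
Lemma legendre_orth_lower m r : (size r <= m)%N -> ipoly (P m * r) = 0.
Proof.
have [_ sz _] := HP.
suff: forall k, (k <= m)%N -> forall r, (size r <= k)%N -> ipoly (P m * r) = 0.
  by move=> /(_ m (leqnn m)); exact.
elim=> [|k IH] km {}r rk.
  by move: rk; rewrite leqn0 size_poly_eq0 => /eqP ->; rewrite mulr0 ipoly0.
rewrite -[r](subrK (r`_k *: P k)) mulrDr ipolyD IH ?(ltnW km)//.
  by rewrite -scalerAr ipolyZ legendre_orth ?gtn_eqF// mulr0 addr0.
apply: size_drop_lead.
  rewrite (leq_trans (size_polyD _ _))// geq_max rk size_polyN.
  by rewrite (leq_trans (size_scale_leq _ _))// sz.
by rewrite coefB coefZ coef_legendre_lead mulr1 subrr.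
Qed.

(** The difference [D] between [P_m(- X)] and [(-1) ^ m P_m] has degree less
    than [m], because the leading terms cancel, and both polynomials are
    orthogonal to all degrees less than [m]. So [D] is orthogonal to itself. *)
Lemma legendre_parity m z : (P m).[- z] = (-1) ^+ m * (P m).[z].
Proof.
have [_ sz _] := HP.
pose D := (P m \Po - 'X) - (-1) ^+ m *: P m.
have coefD i : D`_i = ((-1) ^+ i - (-1) ^+ m) * (P m)`_i.
  by rewrite coefB coefZ coef_comp_NX mulrBl.
have sD : (size D <= m)%N.
  apply/leq_sizeP => i; rewrite coefD leq_eqVlt => /orP[/eqP <-|mi].
    by rewrite subrr mul0r.
  by rewrite nth_default ?mulr0// sz.
suff D0 : D = 0.
  by rewrite -comp_polyNX -hornerZ; congr horner; exact: subr0_eq.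
(* Reflecting the remaining integral of [P_m(- X) * D] moves the reflection
   onto [D], whose degree stays below [m]. *)
apply: ipoly_sq_eq0; rewrite {1}/D mulrBl -scalerAl -scaleNr ipolyD ipolyZ.
rewrite (legendre_orth_lower sD) mulr0 addr0 -ipoly_opp comp_polyM.
rewrite -comp_polyA rmorphN/= comp_polyX opprK comp_polyXr.
apply: legendre_orth_lower; apply/leq_sizeP => j mj.
by rewrite coef_comp_NX nth_default ?mulr0// (leq_trans sD).
Qed.

Lemma legendre_odd j z : (P j.*2.+1).[- z] = - (P j.*2.+1).[z].
Proof. by rewrite legendre_parity -signr_odd/= odd_double expr1 mulN1r. Qed.

Lemma legendre1 : P 1 = 'X.
Proof.
have [_ sz _] := HP.
have P10 : (P 1)`_0 = 0.
  have := legendre_odd 0 0; rewrite oppr0 -horner_coef0.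
  by move=> h; lra.
apply/polyP => -[|[|i]]; rewrite coefX//=; first exact: coef_legendre_lead.
by rewrite nth_default// sz.
Qed.

End Legendre.

(** * Odd interpolation and the quadrature *)

Section Interpolation.
Variables (R : realType) (P : nat -> {poly R}).
Hypothesis HP : legendre P.
Variables (d : nat) (x : 'I_d -> R).
Hypotheses (x01 : forall i, 0 < x i <= 1) (xinj : injective x).
Implicit Types (p q : {poly R}) (f : R -> R).

Lemma node_gt0 i : 0 < x i. Proof. by have /andP[] := x01 i. Qed.

Lemma node_itv i : x i \in `[(-1 : R), 1].
Proof. by have /andP[x0 x1] := x01 i; rewrite in_itv/= x1 andbT; lra. Qed.

Lemma node_opp_itv i : - x i \in `[(-1 : R), 1].
Proof.
by have /andP[x0 x1] := x01 i; rewrite in_itv/=; apply/andP; split; lra.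
Qed.

(** Oddness doubles the roots: [x_i] and [- x_i] are [2d] distinct points,
    since the nodes are distinct and positive. *)
Lemma odd_poly_eq0 p : (size p <= d.*2)%N ->
  (forall z, p.[- z] = - p.[z]) -> (forall i, p.[x i] = 0) -> p = 0.
Proof.
move=> sp p_odd px; apply/eqP/negPn/negP => pn0.
have: (size (codom x ++ codom (fun i => - x i)) < size p)%N; last first.
  by rewrite size_cat !size_codom card_ord addnn ltnNge sp.
apply: max_poly_roots => //.
  rewrite all_cat; apply/andP; split; apply/allP => _ /codomP[i ->].
    exact/rootP.
  by apply/rootP; rewrite p_odd px oppr0.
rewrite cat_uniq; apply/and3P; split; [exact/injectiveP| |]; last first.
  by apply/injectiveP => i j /oppr_inj/xinj.
apply/hasPn => _ /codomP[i ->]; apply/negP => /codomP[j xij].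
have := node_gt0 j; rewrite -xij oppr_gt0 => xi_lt0.
by have := lt_trans xi_lt0 (node_gt0 i); rewrite ltxx.
Qed.

Definition odd_comb (c : 'I_d -> R) : {poly R} :=
  \sum_(j < d) c j *: P j.*2.+1.

Lemma horner_odd_comb c z :
  (odd_comb c).[z] = \sum_(j < d) c j * (P j.*2.+1).[z].
Proof. by rewrite horner_sum; apply: eq_bigr => j _; rewrite hornerZ. Qed.

Lemma odd_comb_opp c z : (odd_comb c).[- z] = - (odd_comb c).[z].
Proof.
rewrite !horner_odd_comb -sumrN; apply: eq_bigr => j _.
by rewrite (legendre_odd HP) mulrN.
Qed.

Lemma size_odd_comb c : (size (odd_comb c) <= d.*2)%N.
Proof.
have [_ sz _] := HP.
apply: (leq_trans (size_sum _ _ _)); apply/bigmax_leqP => j _.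
apply: (leq_trans (size_scale_leq _ _)).
by rewrite sz -doubleS leq_double.
Qed.

(** Coefficients are read off by orthogonality, as Fourier coefficients. *)
Lemma ipoly_odd_comb c (k : 'I_d) :
  ipoly (P k.*2.+1 * odd_comb c) = c k * ipoly (P k.*2.+1 * P k.*2.+1).
Proof.
rewrite mulr_sumr ipoly_sum (bigD1 k)//= -scalerAr ipolyZ big1 ?addr0// => j jk.
rewrite -scalerAr ipolyZ (legendre_orth HP) ?mulr0//.
by rewrite eqSS -!muln2 eqn_pmul2r// eq_sym.
Qed.

Lemma det_legendre_mx_neq0 : \det (legendre_mx P x) != 0.
Proof.
rewrite -det_tr; apply/negP => /det0P[v /eqP vn0 vV]; apply: vn0.
have c0 : odd_comb (v 0) = 0.
  apply: odd_poly_eq0 (size_odd_comb _) (odd_comb_opp _) _ => i.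
  have /rowP/(_ i) := vV; rewrite !mxE => <-.
  by rewrite horner_odd_comb; apply: eq_bigr => j _; rewrite !mxE.
apply/rowP => k; rewrite mxE; have := ipoly_odd_comb (v 0) k.
rewrite c0 mulr0 ipoly0 => /esym/eqP.
by rewrite mulf_eq0 (negbTE (legendre_sq_neq0 HP _)) orbF => /eqP.
Qed.

(** Solve the invertible system at the nodes; the error is odd, has degree less
    than [2d] and vanishes at the nodes. *)
Lemma odd_interpolation p : (size p <= d.*2)%N ->
  (forall z, p.[- z] = - p.[z]) -> exists c, p = odd_comb c.
Proof.
move=> sp p_odd.
have Vu : legendre_mx P x \in unitmx.
  by rewrite unitmxE unitfE det_legendre_mx_neq0.
pose b : 'cV[R]_d := \col_i p.[x i].
pose c := invmx (legendre_mx P x) *m b.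
exists (c^~ 0); apply/subr0_eq/odd_poly_eq0.
- rewrite (leq_trans (size_polyD _ _))// geq_max sp size_polyN.
  exact: size_odd_comb.
- by move=> z; rewrite !hornerE p_odd odd_comb_opp; ring.
move=> i; rewrite hornerD hornerN horner_odd_comb.
have /colP/(_ i) : legendre_mx P x *m c = b by rewrite mulKVmx.
rewrite !mxE => <-; apply/eqP; rewrite subr_eq0; apply/eqP.
by apply: eq_bigr => j _; rewrite mxE mulrC.
Qed.

Hypothesis hd : (1 <= d)%N.
Let j0 : 'I_d := Ordinal hd.
Let V := legendre_mx P x.

(** Laplace expansion of the numerator along its first column: its cofactors
    there do not see that column, so they are those of the denominator. *)
Lemma q1E f : q1 P x f =
  \sum_i (f (x i) - f 0) / x i * (cofactor V i j0 / \det V).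
Proof.
rewrite /q1 (expand_det_col _ j0) mulr_suml; apply: eq_bigr => i _.
rewrite mxE/= -[LHS]mulrA; congr (_ * _).
congr (_ / _); rewrite /cofactor; congr (_ * \det _).
by apply/matrixP => k l; rewrite !mxE/=.
Qed.

(** Cramer's rule, in the form [\adj V *m V = \det V]. *)
Lemma q1_interpolant f c :
  (forall i, (f (x i) - f 0) / x i = (odd_comb c).[x i]) -> q1 P x f = c j0.
Proof.
move=> fc; rewrite q1E.
transitivity ((\adj V *m V *m \col_j c j) j0 0 / \det V); last first.
  by rewrite mul_adj_mx mul_scalar_mx !mxE mulrC mulKf// det_legendre_mx_neq0.
rewrite -mulmxA mxE mulr_suml; apply: eq_bigr => i _.
rewrite fc horner_odd_comb !mxE mulrA; congr (_ / _); rewrite mulrC.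
by congr (_ * _); apply: eq_bigr => j _; rewrite !mxE mulrC.
Qed.

(** Dividing [p - p(0)] by [X] leaves an odd polynomial, and integrating it
    against [X = P_1] keeps its first coefficient only. *)
Lemma even_quad_exact p : (size p <= d.*2.+1)%N ->
  (forall z, p.[- z] = p.[z]) -> ipoly p = even_quad P x (horner p).
Proof.
move=> sp p_even.
have [g gE] : exists g, p = p.[0]%:P + g * 'X.
  have /factor_theorem[g] : root (p - p.[0]%:P) 0.
    by rewrite rootE !hornerE subrr.
  by rewrite subr0 => /(canRL (subrK _)) pE; exists g; rewrite addrC.
have gX z : p.[z] = p.[0] + g.[z] * z by rewrite {1}gE !hornerE.
have g_odd z : g.[- z] = - g.[z].
  suff /subr0_eq/(congr1 (horner^~ z)) : g \Po - 'X - - g = 0.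
    by rewrite comp_polyNX hornerN.
  (* Evenness of [p] gives [z * g(- z) = - z * g(z)]; the factor [z] is
     cancelled in the polynomial ring, so that [z = 0] is covered too. *)
  apply/eqP; rewrite -(mulIr_eq0 _ (@mulIf _ 'X _)) ?polyX_eq0//; apply/eqP.
  apply: poly_eq0_itv11 => t _; rewrite !(hornerE, comp_polyNX).
  by have := p_even t; rewrite (gX t) (gX (- t)) => /addrI; lra.
have sg : (size g <= d.*2)%N.
  have [->|gn0] := eqVneq g 0; first by rewrite size_poly0.
  rewrite -ltnS -size_mulX// -(addKr p.[0]%:P (g * 'X)) -gE.
  rewrite (leq_trans (size_polyD _ _))// geq_max sp size_polyN.
  by rewrite (leq_trans (size_polyC_leq1 _)).
have [c cE] := odd_interpolation sg g_odd.
rewrite /even_quad (@q1_interpolant _ c); last first.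
  move=> i; rewrite -cE (gX (x i)) [_ + _ - _]addrC addKr mulfK//.
  by rewrite gt_eqF// node_gt0.
rewrite [in LHS]gE cE mulrC -(legendre1 HP) ipolyD.
rewrite (ipoly_odd_comb c j0) (legendre1 HP) ipolyX2.
have -> : ipoly p.[0]%:P = 2 * p.[0].
  have -> : p.[0]%:P = (p.[0] *: 'X)^`() by rewrite derivZ derivX alg_polyC.
  by rewrite ipoly_deriv !hornerE; ring.
by ring.
Qed.

Let node_weight i : R := 2 / 3 * (cofactor V i j0 / \det V) / x i.

(** The weight of the node [x_i] is recovered from the point [t = x_i] alone: the
    nodes are distinct, so the sum has a single term there. *)
Let quad_weight t : R :=
  if t == 0 then 2 - \sum_i node_weight i
  else \sum_(i | x i == t) node_weight i.

Lemma even_quadE f : even_quad P x f =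
  quad_weight 0 * f 0 + \sum_i quad_weight (x i) * f (x i).
Proof.
have wx i : quad_weight (x i) = node_weight i.
  rewrite /quad_weight gt_eqF ?node_gt0// (big_pred1 i)// => j.
  exact: inj_eq.
under eq_bigr => i _ do rewrite wx.
rewrite /quad_weight eqxx /even_quad q1E mulr_sumr mulrBl mulr_suml.
rewrite addrC -addrA; congr (_ + _); apply/eqP.
rewrite eq_sym addrC subr_eq -big_split/=; apply/eqP/eq_bigr => i _.
by rewrite /node_weight; ring.
Qed.

Lemma even_quad_rule : quadrature_rule (0 :: codom x)
  (fun f => continuous11 f /\ even11 f) (even_quad P x).
Proof.
split=> [t|].
  rewrite in_cons => /predU1P[->|/codomP[i ->]]; last exact: node_itv.
  by rewrite in_itv/=; apply/andP; split; lra.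
by exists quad_weight => f _; rewrite big_cons big_image even_quadE.
Qed.

(** Evaluating the even part splits the weight of [x_i] equally between [x_i]
    and [- x_i]; the nodes being positive, the absolute value recovers [x_i]. *)
Lemma quad_rule :
  quadrature_rule (0 :: codom x ++ codom (fun i => - x i))
    (fun f => continuous11 f) (quad P x).
Proof.
split=> [t|].
  rewrite in_cons mem_cat => /or3P[/eqP ->|/codomP[i ->]|/codomP[i ->]].
  - by rewrite in_itv/=; apply/andP; split; lra.
  - exact: node_itv.
  - exact: node_opp_itv.
exists (fun t => if t == 0 then quad_weight 0 else quad_weight `|t| / 2) => f _.
have -> : quad P x f = even_quad P x (even_part f).
  by rewrite /quad /even_quad [in RHS]/even_part oppr0; field.
rewrite even_quadE big_cons big_cat/= !big_image/= eqxx -big_split/=.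
congr (_ * _ + _); first by rewrite /even_part oppr0; field.
apply: eq_bigr => i _; rewrite oppr_eq0 gt_eqF ?node_gt0// normrN.
by rewrite gtr0_norm ?node_gt0// /even_part; field.
Qed.

End Interpolation.

(** * Exactness of the quadrature *)

Theorem theorem2p6 (R : realType) (P : nat -> {poly R}) (HP : legendre P)
    (d : nat) (hd : (1 <= d)%N) (x : 'I_d -> R)
    (x01 : forall i, 0 < x i <= 1) (xinj : injective x) :
  [/\ \det (legendre_mx P x) != 0,
      (quadrature_rule (0 :: codom x)
         (fun f => continuous11 f /\ even11 f) (even_quad P x) /\
       forall p : {poly R}, (size p <= d.*2.+1)%N -> even11 (horner p) ->
         exact_at (even_quad P x) (horner p)),
      (forall f : R -> R, continuous11 f ->
         [/\ forall z, f z = even_part f z + odd_part f z,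
             continuous11 (even_part f) /\ even11 (even_part f),
             integral11 f = integral11 (even_part f) &
             quad P x f = even_quad P x (even_part f)]) &
      (quadrature_rule (0 :: codom x ++ codom (fun i => - x i))
         (fun f => continuous11 f) (quad P x) /\
       forall f : R -> R, continuous11 f ->
         (exists2 p : {poly R}, (size p <= d.*2.+1)%N &
            forall z, z \in `[(-1 : R), 1] -> even_part f z = p.[z]) ->
         exact_at (quad P x) f)].
Proof.
have exact_even (p : {poly R}) : (size p <= d.*2.+1)%N ->
    even11 (horner p) -> exact_at (even_quad P x) (horner p).
  move=> sp p_even; apply: even_quad_exact => // z.
  suff /subr0_eq/(congr1 (horner^~ z)) : p \Po - 'X - p = 0.
    by rewrite comp_polyNX.
  apply: poly_eq0_itv11 => t tI.
  by rewrite hornerD hornerN comp_polyNX p_even// subrr.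
have even_part_even (f : R -> R) : even11 (even_part f).
  by move=> z _; rewrite /even_part opprK addrC.
have quadE f : quad P x f = even_quad P x (even_part f).
  by rewrite /quad /even_quad [in RHS]/even_part oppr0; field.
split.
- exact: det_legendre_mx_neq0.
- by split; [exact: even_quad_rule|].
- move=> f cf; split=> //.
  + by move=> z; rewrite /even_part /odd_part; field.
  + by split; [exact: continuous11_even_part|].
  + by rewrite integral11_even_part.
split; first exact: quad_rule.
move=> f cf [p sp fp]; rewrite /exact_at quadE -integral11_even_part//.
have eI : even11 (horner p).
  move=> z zI; rewrite -!fp//; first exact: even_part_even.
  by move: zI; rewrite !in_itv/= => /andP[z1 z2]; apply/andP; split; lra.
have -> : integral11 (even_part f) = integral11 (horner p).
  by apply: eq_Rintegral => z; rewrite inE/= => zI; exact: fp.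
rewrite exact_even// !(even_quadE P x01 xinj hd).
congr (_ * _ + _).
  by rewrite fp// in_itv/=; apply/andP; split; lra.
by apply: eq_bigr => i _; rewrite fp// node_itv.
Qed.
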